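(* Let $k\ge 2$, $0\le l\le k$ be integers, and let $T'$ be a tree of order $n\ge k+1$ with $T'\not\cong P_n$. Then there is a $\sigma^{-1}$-transformation of $T'$, i.e. a tree $T$ in $\sigma$-form with respect to some $(X,Y,Z,P)$ with $\sigma(T)=T'$, such that $\bar{\varepsilon}_{k,l}(T')\le \bar{\varepsilon}_{k,l}(T)$.
   Context: For a tree $G$ and $S\subseteq V(G)$, $d_G(S)$ is the number of edges of the minimal subtree of $G$ containing $S$. For an $l$-subset $S$ of $V(G)$ ($n=|V(G)|$), $\varepsilon_{k,l}(S;G)=\max\{d_G(S'): S\subseteq S'\subseteq V(G),\ |S'|=k\}$, and $\bar{\varepsilon}_{k,l}(G)=\binom{n}{l}^{-1}\sum_{|S|=l}\varepsilon_{k,l}(S;G)$. For a subtree $H$ of $G$ and $v\in V(H)$, $\varepsilon_H(v)=\max\{d_G(u,v):u\in V(H)\}$. A tree $T$ is in $\sigma$-form with respect to $(X,Y,Z,P)$ if $T$ is the union of a path $P$ from $v_0$ to $v_s$ of length $s\ge1$ and subtrees $X,Y,Z$ such that $Y$ contains $v_0$, $X$ and $Z$ contain $v_s$, $V(Y)\cap V(P)=\{v_0\}$, $V(X)\cap V(P)=V(Z)\cap V(P)=V(X)\cap V(Z)=\{v_s\}$, $Y$ is disjoint from $X\cup Z$, $Z$ has a vertex other than $v_s$ ($X=\{v_s\}$ allowed), $\varepsilon_Y(v_0)\ge\max\{\varepsilon_X(v_s),\varepsilon_Z(v_s)\}$, and $|V(Y)|\ge|V(X)|$. Then $\sigma(T)$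 is obtained by replacing every edge $v_sz$, $z\in V(Z)\setminus\{v_s\}$, by $v_0z$ (moving $Z$ from $v_s$ to $v_0$); passing from $\sigma(T)$ back to $T$ is a $\sigma^{-1}$-transformation. *)

(* Defs.v *)
From mathcomp Require Import all_boot all_order all_algebra.

Set Implicit Arguments.
Unset Strict Implicit.
Unset Printing Implicit Defensive.

Section Trees.
Variable V : finType.
Implicit Types (e : rel V) (A S H : {set V}) (u v : V).

Definition induced e A : rel V := [rel x y | [&& x \in A, y \in A & e x y]].

Definition connected_in e A : bool :=
  [forall x in A, forall y in A, connect (induced e A) x y].

(* The lengths are bounded only to get a boolean: a duplicate-free sequence
   over V has at most #|V| entries. *)
Definition acyclic e : bool :=
  [forall m : 'I_#|V|.+1, forall c : m.-tuple V, ucycleb e c ==> (m < 3)].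

(* A connected subgraph of a tree is an induced subgraph, so subtrees are
   represented by their vertex sets. *)
Definition subtree e A : bool :=
  [&& A != set0, connected_in e A & acyclic (induced e A)].

Definition is_tree e : Prop :=
  [/\ symmetric e, irreflexive e & subtree e [set: V]].

Definition nb_edges e A : nat :=
  #|[set [set x; y] | x in A, y in A & e x y]|.

(* When e is a tree, [set: V] is a legitimate candidate. *)
Definition min_subtree e S : {set V} :=
  [arg min_(A < [set: V] | subtree e A && (S \subset A)) nb_edges e A].

Definition steiner_dist e S : nat := nb_edges e (min_subtree e S).

(* Meant for k-sets S' ranging over a nonempty family, i.e.
   #|S| <= k <= #|V|. *)
Definition steiner_ecc e (k : nat) S : nat :=
  \max_(S' : {set V} | (S \subset S') && (#|S'| == k)) steiner_dist e S'.

Definition avg_steiner_ecc e (k l : nat) : rat :=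
  ((\sum_(S : {set V} | #|S| == l) steiner_ecc e k S)%N%:R
     / 'C(#|V|, l)%:R)%R.

(* Length of a shortest walk; the value #|V| for disconnected u, v never
   occurs in a tree. *)
Definition dist e u v : nat :=
  find (fun m => [exists q : m.-tuple V, path e u q && (last u q == v)])
       (iota 0 #|V|).

Definition ecc e H v : nat := \max_(u in H) dist e u v.

(* The path P is v0 :: p. *)
Definition path_edge v0 (p : seq V) : rel V :=
  [rel x y | ((x, y) \in zip (v0 :: p) p) || ((y, x) \in zip (v0 :: p) p)].

Record sigma_form e v0 vs (p : seq V) (X Y Z : {set V}) : Prop := SigmaForm {
  sf_tree : is_tree e;
  sf_path : path e v0 p;
  sf_uniq : uniq (v0 :: p);
  sf_last : last v0 p = vs;
  sf_length : 1 <= size p;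
  sf_subX : subtree e X;
  sf_subY : subtree e Y;
  sf_subZ : subtree e Z;
  sf_vertices : X :|: Y :|: Z :|: [set x in v0 :: p] = [set: V];
  sf_edges : forall x y, e x y ->
    [|| (x \in X) && (y \in X), (x \in Y) && (y \in Y),
        (x \in Z) && (y \in Z) | path_edge v0 p x y];
  sf_YP : Y :&: [set x in v0 :: p] = [set v0];
  sf_XP : X :&: [set x in v0 :: p] = [set vs];
  sf_ZP : Z :&: [set x in v0 :: p] = [set vs];
  sf_XZ : X :&: Z = [set vs];
  sf_Y_XZ : [disjoint Y & X :|: Z];
  sf_Z_nontrivial : exists2 z, z \in Z & z != vs;
  sf_ecc : maxn (ecc e X vs) (ecc e Z vs) <= ecc e Y v0;
  sf_card : #|X| <= #|Y| }.

Definition sigma e v0 vs (Z : {set V}) : rel V :=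
  let moved z := (z \in Z :\ vs) && e vs z in
  [rel x y | [|| [&& e x y, ~~ ((x == vs) && moved y)
                          & ~~ ((y == vs) && moved x)],
                 (x == v0) && moved y | (y == v0) && moved x]].

End Trees.

Definition path_graph n : rel 'I_n :=
  [rel i j : 'I_n | (i.+1 == j) || (j.+1 == i)].

Definition graph_iso (V W : finType) (e : rel V) (f : rel W) : Prop :=
  exists2 h : V -> W, bijective h & forall x y, f (h x) (h y) = e x y.

(* Main.v *)
(* Root T' at a leaf r and let v0 be the vertex of least depth with at least two
   children, so that the vertices of depth at most that of v0 form a path P
   from r to v0.  Among the children of v0 choose c such that the branch Z at c
   misses a deepest vertex m of T', and let Y be the rest of the part of T'
   beyond v0.  The tree T hangs the branch at c under r instead of v0; here
   vs = r and X = {r}.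
   Let phi reverse P.  To an l-set S associate phi(S) if S meets Z but not Y,
   and S itself otherwise; this is a bijection of the l-sets, and it does not
   decrease the Steiner eccentricity from T' to T.  Let S' be optimal for S in
   T'.  If S is reversed, phi(S') does at least as well in T.  Otherwise S'
   itself does, unless S' misses Y, S lies in P, and S' meets Z in some w; then
   w is exchanged for m. *)
Require Import Defs.
From mathcomp Require Import all_boot all_order all_algebra.
From mathcomp Require Import zify.

Set Implicit Arguments.
Unset Strict Implicit.
Unset Printing Implicit Defensive.

Lemma path_traject (T : Type) (R : rel T) (f : T -> T) n x :
  (forall i, i < n -> R (iter i f x) (f (iter i f x))) ->
  path R x (traject f (f x) n).
Proof.
elim: n x => // n IHn x xR /=; rewrite (xR 0) //=.
by apply: IHn => i lti; rewrite -iterSr xR.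
Qed.

(** * Connectivity and cycles in induced subgraphs *)

Section Connectivity.
Variable V : finType.
Implicit Types (e R : rel V) (A B : {set V}) (x y a : V).

Lemma connect_ind_pred R (Q : V -> Prop) x y :
  (forall u v, R u v -> Q u -> Q v) -> connect R x y -> Q x -> Q y.
Proof.
move=> QR /connectP[p + ->]; elim: p x => [|z p IHp] x //= /andP[Rxz Rp] Qx.
exact: IHp Rp (QR _ _ Rxz Qx).
Qed.

Lemma induced_sym e A : symmetric e -> symmetric (induced e A).
Proof. by move=> se x y; rewrite /induced /= se andbCA. Qed.

Lemma connected_inP e A :
  reflect {in A &, forall x y, connect (induced e A) x y} (connected_in e A).
Proof.
apply: (iffP forall_inP) => [cA x y Ax Ay|cA x Ax].
  exact: (forall_inP (cA x Ax)).
by apply/forall_inP => y Ay; apply: cA.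
Qed.

Lemma connect_induced_sub e A B x y : A \subset B ->
  connect (induced e A) x y -> connect (induced e B) x y.
Proof.
move=> /subsetP sAB; apply: connect_sub => u v /and3P[Au Av euv].
by apply: connect1; rewrite /induced /= euv !sAB.
Qed.

Lemma connected_in_hub e A a : symmetric e ->
  {in A, forall x, connect (induced e A) x a} -> connected_in e A.
Proof.
move=> se Aa; apply/connected_inP => x y Ax Ay.
apply: connect_trans (Aa x Ax) _.
by rewrite (sym_connect_sym (induced_sym A se)) Aa.
Qed.

Lemma connected_inU e A B a : symmetric e -> a \in A -> a \in B ->
  connected_in e A -> connected_in e B -> connected_in e (A :|: B).
Proof.
move=> se Aa Ba /connected_inP cA /connected_inP cB.
apply: (connected_in_hub (a := a)) => // x /setUP[Ax|Bx].
  by apply: connect_induced_sub (cA _ _ Ax Aa); apply: subsetUl.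
by apply: connect_induced_sub (cB _ _ Bx Ba); apply: subsetUr.
Qed.

Lemma acyclic_sub e e' : subrel e e' -> acyclic e' -> acyclic e.
Proof.
move=> see' /forallP ae'; apply/forallP => m; apply/forallP => c.
apply/implyP => /andP[ec uc]; apply: (implyP (forallP (ae' m) c)).
by rewrite /ucycleb uc (sub_cycle see').
Qed.

Lemma acyclic_ucycle e c : acyclic e -> cycle e c -> uniq c -> size c < 3.
Proof.
move=> /forallP ae ec uc.
have sc : size c < #|V|.+1 by rewrite ltnS -(card_uniqP uc) max_card.
have := forallP (ae (Ordinal sc)) (in_tuple c).
by rewrite /ucycleb /= ec uc.
Qed.

End Connectivity.

(** * Rooted trees given by parent and height functions *)

Section Rooted.
Variable V : finType.
Implicit Types (e : rel V) (r x y : V) (A K S : {set V}).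

(** Letting [par] fix the root keeps its iterates total, so that [fconnect par x y] says that [y] is
    [x] or an ancestor of [x]. *)
Record rooted e r (par : V -> V) (h : V -> nat) : Prop := Rooted {
  rooted_height0 : h r = 0;
  rooted_par_root : par r = r;
  rooted_heightS : forall x, x != r -> h x = (h (par x)).+1;
  rooted_edge : forall x y,
    e x y = (x != r) && (y == par x) || (y != r) && (x == par y) }.

(** Take [h x] to be the least length of a walk from [r] to [x]; the last but one vertex of a
    shortest walk serves as [w]. *)
Lemma walk_height e r : connected_in e setT ->
  exists h : V -> nat, h r = 0 /\
    forall x, x != r -> exists2 w, e w x & h x = (h w).+1.
Proof.
move=> /connected_inP ce.
pose walk x m := [exists q : m.-tuple V, path e r q && (last r q == x)].
have walkE x q : path e r q -> last r q = x -> walk x (size q).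
  move=> eq lq; apply/existsP; exists (in_tuple q) => /=.
  by rewrite eq lq eqxx.
have ex_walk x : exists m, walk x m.
  have /connectP[q eq ->] := ce r x (in_setT _) (in_setT _).
  exists (size q); apply: walkE => //.
  by apply: sub_path eq => u v /and3P[].
exists (fun x => ex_minn (ex_walk x)); split.
  by case: ex_minnP => m _ /(_ 0 (walkE r [::] isT erefl)); case: m.
move=> x xr; case: ex_minnP => m /existsP[[q /= /eqP sq] /andP[eq /eqP lq]] minm.
case/lastP: q => [|q z] in sq eq lq *; first by rewrite -lq eqxx in xr.
rewrite last_rcons in lq; rewrite lq rcons_path size_rcons in sq eq.
case/andP: eq => eq ewx; exists (last r q) => //.
case: ex_minnP => k /existsP[[q' /= /eqP sq'] /andP[eq' /eqP lq']] mink.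
apply/eqP; rewrite eqn_leq -{2}sq ltnS mink ?walkE // andbT.
rewrite -sq' -(size_rcons q' x); apply/minm/walkE; last by rewrite last_rcons.
by rewrite rcons_path eq' lq'.
Qed.

(** The parent of [x] is a neighbour one step closer to [r]. Parent edges alone join all vertices to
    [r], so any further edge would close a cycle. *)
Lemma tree_rooted e r : is_tree e ->
  exists (par : V -> V) (h : V -> nat), rooted e r par h.
Proof.
case=> se ie /and3P[_ ce ae].
have [h [hr hP]] := walk_height r ce.
pose up x w := e w x && (h x == (h w).+1).
pose par x := if x == r then r else odflt r [pick w | up x w].
have parP x : x != r -> e (par x) x /\ h x = (h (par x)).+1.
  rewrite /par => xr; rewrite (negbTE xr).
  case: pickP => [w /andP[ewx /eqP]//|none].
  by have [w ewx hx] := hP x xr; have := none w; rewrite /up ewx hx eqxx.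
exists par, h; split=> // [|x /parP[]//|x y]; first by rewrite /par eqxx.
apply/idP/idP => [exy|/orP[]/andP[/parP[epar _] /eqP->]//]; last first.
  by rewrite se.
apply/negPn/negP; rewrite negb_or => /andP[xy yx].
(* Delete the edge xy, assumed not to be a parent edge: all vertices still climb to [r]. *)
pose f u v := e u v && ~~ ((u == x) && (v == y) || (u == y) && (v == x)).
have sf : symmetric f.
  by move=> u v; rewrite /f se orbC ![(v == _) && _]andbC.
have fr u : connect f u r.
  have [k] := ubnP (h u); elim: k u => // k IHk u hk.
  have [->|ur] := eqVneq u r; first exact: connect0.
  have [epar hu] := parP u ur.
  apply: connect_trans (IHk (par u) _); last by rewrite -ltnS -hu.
  apply: connect1; rewrite /f se epar /=.
  apply/negP => /orP[]/andP[/eqP eu /eqP pu]; subst u.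
    by rewrite ur pu eqxx in xy.
  by rewrite ur pu eqxx in yx.
have /connectP[p] : connect f x y.
  by apply: connect_trans (fr x) _; rewrite (sym_connect_sym sf).
case/shortenP=> q fq uq _ ly.
(* Without that edge a path from [x] to [y] has an inner vertex, so together with the edge it is a
   cycle of length at least 3. *)
suff : size (x :: q) < 3.
  case: q => [|z [|//]] in fq uq ly *.
    by rewrite /= in ly; rewrite ly ie in exy.
  by move: fq; rewrite /= in ly *; rewrite /f -ly !eqxx /= andbF.
apply: (@acyclic_ucycle _ e) uq.
  by apply: acyclic_sub ae => u v euv; rewrite /induced /= !inE.
rewrite /= rcons_path -ly se exy andbT.
by apply: sub_path fq => u v /andP[].
Qed.

Section RootedTheory.
Variables (e : rel V) (r : V) (par : V -> V) (h : V -> nat).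
Hypothesis rt : rooted e r par h.

Lemma rooted_sym : symmetric e.
Proof. by move=> x y; rewrite !(rooted_edge rt) orbC. Qed.

Lemma height_par x : h (par x) = (h x).-1.
Proof.
have [->|xr] := eqVneq x r; last by rewrite (rooted_heightS rt xr).
by rewrite (rooted_par_root rt) (rooted_height0 rt).
Qed.

Lemma height_iter i x : h (iter i par x) = h x - i.
Proof. by elim: i => [|i IHi] /=; rewrite ?subn0 // height_par IHi subnS. Qed.

Lemma height_eq0 x : (h x == 0) = (x == r).
Proof.
apply/eqP/eqP => [hx|->]; last exact: rooted_height0 rt.
by apply/eqP/negPn/negP => /(rooted_heightS rt); rewrite hx.
Qed.

Lemma iter_height x : iter (h x) par x = r.
Proof. by apply/eqP; rewrite -height_eq0 height_iter subnn. Qed.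

Lemma edge_par x : x != r -> e x (par x).
Proof. by move=> xr; rewrite (rooted_edge rt) xr eqxx. Qed.

Lemma connect_iter A i x :
  (forall j, j <= i -> iter j par x \in A) ->
  connect (induced e A) x (iter i par x).
Proof.
elim: i => [|i IHi] Ax; first exact: connect0.
apply: connect_trans (IHi _) _ => [j ji|]; first by apply: Ax; apply: leqW.
have [ir|nr] := eqVneq (iter i par x) r.
  by rewrite iterS ir (rooted_par_root rt).
by apply: connect1; rewrite /induced /= edge_par // -iterS !Ax.
Qed.

Lemma connected_in_par A a :
  (forall x, x \in A -> x != a -> (par x \in A) && (x != r)) ->
  connected_in e A.
Proof.
move=> Apar; apply: (connected_in_hub (a := a) rooted_sym) => x.
have [k] := ubnP (h x); elim: k x => // k IHk x hk Ax.
have [->|xa] := eqVneq x a; first exact: connect0.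
have /andP[Apx xr] := Apar x Ax xa.
apply: connect_trans (IHk (par x) _ Apx).
  by apply: connect1; rewrite /induced /= Ax Apx edge_par.
by rewrite -ltnS -(rooted_heightS rt).
Qed.

(** On a cycle, both neighbours of a vertex of greatest height are its parent, which is impossible
    for a duplicate-free cycle of length at least 3. *)
Lemma rooted_tree : is_tree e.
Proof.
split; first exact: rooted_sym.
  move=> x; rewrite (rooted_edge rt) orbb; apply/negP => /andP[xr /eqP xp].
  by have := rooted_heightS rt xr; rewrite -xp => /n_Sn.
apply/and3P; split.
- by apply/set0Pn; exists r.
- by apply: (connected_in_par (a := r)) => x _ ->; rewrite inE.
apply: (@acyclic_sub _ _ e) => [x y /and3P[]//|].
apply/forallP => m; apply/forallP => c; apply/implyP => /andP[ec uc].
rewrite ltnNge; apply/negP; rewrite -(size_tuple c).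
case: c ec uc => -[|x0 c0]//= _; set c := x0 :: c0 => ec uc sc.
have [x cx maxx] : exists2 x, x \in c & {in c, forall y, h y <= h x}.
  have c0x : x0 \in c by rewrite mem_head.
  by case: (arg_maxnP h c0x) => x cx maxx; exists x.
have [i q def_c] := rot_to cx.
have {}ec : cycle e (x :: q) by rewrite -def_c rot_cycle.
have {}uc : uniq (x :: q) by rewrite -def_c rot_uniq.
have sq : 2 < size (x :: q) by rewrite -def_c size_rot.
have parE y : y \in x :: q -> e x y -> y = par x.
  rewrite -def_c mem_rot => /maxx hyx.
  rewrite (rooted_edge rt) => /orP[/andP[_ /eqP]//|/andP[yr /eqP xp]].
  by move: hyx; rewrite (rooted_heightS rt yr) -xp ltnn.
case: q => [|y q] //= in ec uc sq parE def_c *.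
move: ec; rewrite rcons_path => /and3P[exy _ ezx].
have y_p : y = par x by apply: parE exy; rewrite !inE eqxx orbT.
have z_p : last y q = par x.
  by apply: parE; [rewrite inE mem_last orbT | rewrite rooted_sym].
move: uc => /and3P[_ + _]; rewrite y_p -z_p; case: q {parE def_c ezx z_p} sq => // z q _.
by rewrite /= mem_last.
Qed.

(* The sets closed under [par] containing [a] contain all ancestors of [a], so
   [x] is not an ancestor of [a] and every walk from [x] to [a] uses [par x]. *)
Lemma connected_in_climb A K a x : connected_in e A ->
  (forall y, y \in K -> par y \in K) -> a \in A -> a \in K ->
  x \in A -> x \notin K -> par x \in A.
Proof.
move=> /connected_inP cA Kpar Aa Ka Ax Kx; apply: contraNT Kx => Apx.
suff /iter_findex <- : fconnect par a x by elim: (findex _ _ _) => //= i /Kpar.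
apply: (connect_ind_pred (Q := fun y => fconnect par y x) _ (cA _ _ Ax Aa));
  last exact: connect0.
move=> u v /and3P[Au Av].
rewrite (rooted_edge rt) => /orP[/andP[_ /eqP vp]|/andP[_ /eqP->] ux]; last first.
  by apply: connect_trans ux; apply: fconnect1.
have [ux|ux] := eqVneq u x; first by rewrite -ux -vp Av in Apx.
move/iter_findex; case: (findex _ _ _) => [/=|i]; first by move/eqP/negPn; rewrite ux.
by rewrite iterSr -vp => <-; apply: fconnect_iter.
Qed.

(** Sending each vertex of [A], except the one closest to the root, to the edge to its parent is a
    bijection onto the edges inside [A]. *)
Lemma nb_edges_connected A : A != set0 -> connected_in e A ->
  nb_edges e A = #|A|.-1.
Proof.
case/set0Pn=> a0 Aa0 cA.
have [a Aa min_a] : exists2 a, a \in A & {in A, forall x, h a <= h x}.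
  by case: (arg_minnP h Aa0) => a; exists a.
have xr x : x \in A -> x != a -> x != r.
  move=> Ax; apply: contraNneq => xr; have := min_a x Ax.
  by rewrite xr (rooted_height0 rt) leqn0 height_eq0 eq_sym.
have Apar x : x \in A -> x != a -> par x \in A.
  (* Climbing from a vertex other than [x] of height at most [h x] never meets [x], so
     [connected_in_climb] applies to this [K]. *)
  move=> Ax xa; pose K := [set y | (h y <= h x) && (y != x)].
  apply: (connected_in_climb (K := K) (a := a) cA) => // [y||]; last 1 first.
  - by rewrite inE eqxx andbF.
  - rewrite !inE height_par => /andP[hyx yx]; rewrite (leq_trans (leq_pred _) hyx) /=.
    have [->|yr] := eqVneq y r; first by rewrite (rooted_par_root rt) eq_sym xr.
    by apply: contraTneq hyx => <-; rewrite -ltnNge (rooted_heightS rt yr).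
  - by rewrite inE min_a //= eq_sym.
pose edge x := [set x; par x].
rewrite /nb_edges (cardsD1 a A) Aa /= -(card_in_imset (f := edge) (D := A :\ a)).
  apply: eq_card => E; apply/imset2P/imsetP => [[x y Ax]|[x]].
    rewrite inE (rooted_edge rt) => /andP[Ay /orP[]/andP[xnr /eqP def] ->].
      exists x; last by rewrite /edge def.
      rewrite !inE Ax andbT; apply: contraTneq Ay => xa.
      by apply/negP => /min_a; rewrite -xa def (rooted_heightS rt xnr) ltnn.
    exists y; last by rewrite /edge def setUC.
    rewrite !inE Ay andbT; apply: contraTneq Ax => ya.
    by apply/negP => /min_a; rewrite -ya def (rooted_heightS rt xnr) ltnn.
  rewrite !inE => /andP[xa Ax] ->; exists x (par x) => //.
  by rewrite inE Apar // edge_par // xr.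
move=> x y; rewrite !inE => /andP[xa Ax] /andP[ya Ay] /setP Exy.
have := Exy x; rewrite !inE eqxx /= => /esym/orP[/eqP//|/eqP xy].
have := Exy y; rewrite !inE eqxx /= => /orP[/eqP//|/eqP yx].
have := rooted_heightS rt (xr x Ax xa); rewrite -yx.
by rewrite (rooted_heightS rt (xr y Ay ya)) -xy; lia.
Qed.

Lemma connected_subtree A : A != set0 -> connected_in e A -> subtree e A.
Proof.
move=> A0 cA; have [_ _ /and3P[_ _ aV]] := rooted_tree.
rewrite /subtree A0 cA; apply: acyclic_sub aV => x y /and3P[_ _].
by rewrite /induced /= !inE.
Qed.

(** Connected sets have one edge fewer than vertices, so with [steiner_dist_witness] the Steiner
    distance is the least [#|A|.-1] over the nonempty connected [A] containing [S]. *)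
Lemma steiner_dist_le S A : A != set0 -> connected_in e A -> S \subset A ->
  steiner_dist e S <= #|A|.-1.
Proof.
move=> A0 cA SA; rewrite -nb_edges_connected //.
have [_ _ treeV] := rooted_tree.
rewrite /steiner_dist /min_subtree; case: arg_minnP => [|B _]; last first.
  by apply; rewrite connected_subtree.
by rewrite treeV subsetT.
Qed.

Lemma steiner_dist_witness S : exists A : {set V},
  [/\ A != set0, connected_in e A, S \subset A & steiner_dist e S = #|A|.-1].
Proof.
have [_ _ treeV] := rooted_tree.
rewrite /steiner_dist /min_subtree; case: arg_minnP => [|B].
  by rewrite treeV subsetT.
case/andP=> /and3P[B0 cB _] SB _; exists B; split=> //.
exact: nb_edges_connected.
Qed.

(** Only parent edges have to be followed, and each may become a walk inside the image or collapse
    to a point. *)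
Lemma connected_in_image e1 r1 par1 h1 (f : V -> V) A :
  rooted e1 r1 par1 h1 ->
  (forall x, x \in A -> par1 x \in A -> x != r1 ->
    connect (induced e (f @: A)) (f x) (f (par1 x))) ->
  connected_in e1 A -> connected_in e (f @: A).
Proof.
move=> rt1 fP /connected_inP cA.
have cs := sym_connect_sym (induced_sym (f @: A) rooted_sym).
apply/connected_inP => _ _ /imsetP[x Ax ->] /imsetP[y Ay ->].
apply: (connect_ind_pred (Q := fun y => connect (induced e (f @: A)) (f x) (f y))
  _ (cA x y Ax Ay)) => [u v /and3P[Au Av]|]; last exact: connect0.
rewrite (rooted_edge rt1) => uv xu; apply: connect_trans xu _.
by case/orP: uv Au Av => /andP[nr /eqP->] Au Av; last rewrite cs; apply: fP.
Qed.

Lemma dist_le_height x : dist e x r <= h x.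
Proof.
rewrite /dist leqNgt; apply/negP => lt_find.
have hx : h x < #|V|.
  by apply: leq_trans lt_find _; rewrite -[X in _ <= X](size_iota 0) find_size.
have := before_find 0 lt_find; rewrite nth_iota // add0n => /negbT/negP; apply.
apply/existsP; exists (Tuple (introT eqP (size_traject par (par x) (h x)))) => /=.
rewrite last_traject iter_height eqxx andbT; apply: path_traject => i lti.
by apply: edge_par; rewrite -height_eq0 height_iter subn_eq0 -ltnNge.
Qed.

Lemma height_walk x q : path e x q -> h x <= h (last x q) + size q.
Proof.
elim: q x => [|y q IHq] x /=; first by rewrite addn0.
rewrite (rooted_edge rt) addnS => /andP[/orP[]/andP[nr /eqP def] /IHq le_y].
  by rewrite (rooted_heightS rt nr) -def ltnS.
by rewrite def height_par (leq_trans (leq_pred _)) // leqW.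
Qed.

Lemma dist_le_card x y : dist e x y <= #|V|.
Proof. by rewrite /dist -[X in _ <= X](size_iota 0) find_size. Qed.

(** Heights change by at most one along an edge. The cap [#|V|] is the value of [dist] when the
    search over lengths below [#|V|] fails. *)
Lemma height_le_dist x y : minn (h x - h y) #|V| <= dist e x y.
Proof.
have := dist_le_card x y; rewrite /dist; set a := fun _ => _.
rewrite geq_min leq_eqVlt => /orP[/eqP->|lt_find]; first by rewrite leqnn orbT.
have : has a (iota 0 #|V|) by rewrite has_find size_iota.
move/(nth_find 0); rewrite nth_iota // add0n {1}/a.
case/existsP=> q /andP[/height_walk + /eqP lq]; rewrite lq size_tuple.
by rewrite -leq_subLR => ->.
Qed.

Lemma height_lt_card x : h x < #|V|.
Proof.
rewrite -[X in X <= _]card_ord.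
apply: (leq_card (fun i : 'I_(h x).+1 => iter i par x)) => i j.
move/(congr1 h); rewrite !height_iter => hij.
by apply/val_inj => /=; have := ltn_ord i; have := ltn_ord j; lia.
Qed.
End RootedTheory.

(** All comparisons of Steiner distances go through this: a best connected set for [S] is converted
    into a no larger candidate for [S']. *)
Lemma steiner_dist_transfer e e' r r' par par' h h' S S' :
  rooted e r par h -> rooted e' r' par' h' ->
  (forall A, connected_in e A -> A != set0 -> S \subset A ->
    exists B : {set V}, [/\ connected_in e' B, S' \subset B, B != set0 & #|B| <= #|A|]) ->
  steiner_dist e' S' <= steiner_dist e S.
Proof.
move=> rt rt' tr; have [A [A0 cA SA ->]] := steiner_dist_witness rt S.
have [B [cB S'B B0 leBA]] := tr A cA A0 SA.
by apply: leq_trans (steiner_dist_le rt' B0 cB S'B) _; rewrite -!subn1 leq_sub2r.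
Qed.
End Rooted.

(** * The tree with the branch at [c] moved from [v0] to the root *)

Section MovedBranch.
Variables (V : finType) (e : rel V) (r : V) (par : V -> V) (h : V -> nat).
Variables (v0 c m : V).
Hypothesis rt : rooted e r par h.
Hypothesis height_v0 : 0 < h v0.
Hypothesis unique_level : forall x y, h x = h y -> h x <= h v0 -> x = y.
Hypothesis height_c : h c = (h v0).+1.
Hypothesis m_top : forall x, h x <= h m.
Hypothesis m_c : ~~ fconnect par m c.
Implicit Types (x y z u : V) (A B S : {set V}).

Local Notation s := (h v0).
(* [stem], [branch] and [others] are P, Z \ {vs} and Y \ {v0}, with vs = r. *)
Definition stem := [set x | h x <= h v0].
Definition branch := [set x | fconnect par x c].
Definition others := [set x | (h v0 < h x) && ~~ fconnect par x c].
Definition moved_par x := if x == c then r else par x.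
Definition moved_height x := if x \in branch then h x - h v0 else h x.
Definition moved_edge : rel V := [rel x y |
  (x != r) && (y == moved_par x) || (y != r) && (x == moved_par y)].
Definition reverse x := if h x <= h v0 then iter (h x) par v0 else x.

Local Notation Zo := branch.
Local Notation Yo := others.
Local Notation e1 := moved_edge.
Local Notation phi := reverse.

Lemma par_c : par c = v0.
Proof. by apply: unique_level; rewrite (height_par rt) height_c. Qed.

Lemma c_branch : c \in Zo. Proof. by rewrite inE connect0. Qed.

Lemma c_neq_r : c != r.
Proof. by rewrite -(height_eq0 rt) height_c. Qed.

Lemma branch_height x : x \in Zo -> s < h x.
Proof.
rewrite inE => /iter_findex; move: (findex _ _ _) => i /(congr1 h).
by rewrite (height_iter rt) height_c; lia.
Qed.

Lemma branch_par x : x \in Zo -> x != c -> par x \in Zo.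
Proof.
rewrite !inE => /iter_findex; case: (findex _ _ _) => [/= ->|i]; first by rewrite eqxx.
by rewrite iterSr => <- _; apply: fconnect_iter.
Qed.

Lemma branchN_par x : x \notin Zo -> par x \notin Zo.
Proof. by apply: contraNN; rewrite !inE; apply: connect_trans; apply: fconnect1. Qed.

Lemma branchN_neq_c x : x \notin Zo -> x != c.
Proof. by apply: contraNneq => ->; apply: c_branch. Qed.

Lemma moved_par_branchN x : x \notin Zo -> moved_par x = par x.
Proof. by rewrite /moved_par => /branchN_neq_c/negbTE ->. Qed.

Lemma stemE x : (x \in stem) = (x \notin Yo) && (x \notin Zo).
Proof.
have := @branch_height x; rewrite !inE [h x <= s]leqNgt.
by case: (fconnect _ _ _) => [/(_ isT)->|_]; rewrite ?andbF ?andbT.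
Qed.

Lemma othersE x : (x \in Yo) = (s < h x) && (x \notin Zo).
Proof. by rewrite !inE. Qed.

Lemma others_branchN x : x \in Yo -> x \notin Zo.
Proof. by rewrite othersE => /andP[]. Qed.

Lemma others_par x : x \in Yo -> par x != v0 -> par x \in Yo.
Proof.
rewrite !othersE => /andP[sx Zx] px; rewrite branchN_par // andbT ltn_neqAle.
rewrite (height_par rt); apply/andP; split; last by case: (h x) sx.
apply: contraNneq px => sp; apply/eqP/unique_level; rewrite (height_par rt) -sp //.
Qed.

Lemma othersN_par x : x \notin Yo -> par x \notin Yo.
Proof.
have [->|xc] := eqVneq x c; first by rewrite par_c [v0 \in _]othersE ltnn.
apply: contraNN; rewrite !othersE (height_par rt) => /andP[sx Zx].
rewrite (leq_trans sx (leq_pred _)) /=; apply: contraNN Zx => Zx.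
exact: branch_par.
Qed.

Lemma m_others : m \in Yo.
Proof. by rewrite othersE inE m_c andbT -height_c m_top. Qed.

(** Up to [v0] every level has a single vertex, so a stem vertex is an ancestor of everything at
    least as deep. *)
Lemma stem_iter x y : x \in stem -> h x <= h y -> x = iter (h y - h x) par y.
Proof.
rewrite inE => sx xy; apply: unique_level => //.
by rewrite (height_iter rt) subKn.
Qed.

Lemma stem_par x : x \in stem -> par x \in stem.
Proof. by rewrite !inE (height_par rt); apply: leq_trans; apply: leq_pred. Qed.

Lemma stem_branchN x : x \in stem -> x \notin Zo.
Proof. by rewrite stemE => /andP[]. Qed.

Lemma root_stem : r \in stem.
Proof. by rewrite inE (rooted_height0 rt). Qed.

Lemma v0_stem : v0 \in stem. Proof. by rewrite inE. Qed.

Lemma rooted_moved : rooted e1 r moved_par moved_height.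
Proof.
have Zr := stem_branchN root_stem.
split=> [|| x xr|//].
- by rewrite /moved_height (negbTE Zr) (rooted_height0 rt).
- by rewrite moved_par_branchN // (rooted_par_root rt).
rewrite /moved_height; have [Zx|Zx] := boolP (x \in Zo); last first.
  by rewrite moved_par_branchN // (negbTE (branchN_par Zx)) (rooted_heightS rt xr).
rewrite /moved_par; have [->|xc] := eqVneq x c.
  by rewrite (negbTE Zr) (rooted_height0 rt) height_c subSnn.
have Zpx := branch_par Zx xc; rewrite Zpx -subSn ?(ltnW (branch_height Zpx)) //.
by rewrite (rooted_heightS rt xr).
Qed.

(** In the moved tree the branch hangs at [r] and [others] at [v0], the opposite ends of the stem,
    so a connected set meeting both runs through the whole stem. *)
Lemma stem_sub A y z : connected_in e1 A -> y \in A -> y \in Yo ->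
  z \in A -> z \in Zo -> stem \subset A.
Proof.
move=> cA Ay Yy Az Zz; pose K := r |: Zo.
have Kpar x : x \in K -> moved_par x \in K.
  case/setU1P=> [->|Zx].
    rewrite moved_par_branchN ?(stem_branchN root_stem) // (rooted_par_root rt).
    exact: setU11.
  rewrite /moved_par; case: eqVneq => [_|xc]; first exact: setU11.
  by rewrite inE branch_par ?orbT.
(* Climbing from [y] stays in [A] until [r] is reached, since [z] lies in the ancestor-closed set
   [K] and the vertices before [r] do not. *)
have Ai i : (iter i par y \in A) && (iter i par y \notin Zo).
  elim: i => [|i /andP[Ai Zi]] /=; first by rewrite Ay others_branchN.
  rewrite branchN_par // andbT.
  have [ir|ir] := eqVneq (iter i par y) r; first by rewrite ir (rooted_par_root rt) -ir.
  rewrite -moved_par_branchN //; apply: (connected_in_climb rooted_moved cA Kpar Az) => //.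
    by rewrite inE Zz orbT.
  by rewrite !inE negb_or ir; move: Zi; rewrite inE.
apply/subsetP => x Px; rewrite (stem_iter (y := y) Px).
  by case/andP: (Ai (h y - h x)).
move: Px Yy; rewrite othersE inE => xs /andP[sy _].
exact: leq_trans xs (ltnW sy).
Qed.

(** The only edge lost on the way back is the one from [c] to [r]. If [A] contains both ends, it
    contains the whole stem by [stem_sub], and in [e] one gets from [c] to [v0] and along the stem
    to [r]. *)
Lemma connected_in_others A y : connected_in e1 A -> y \in A -> y \in Yo ->
  connected_in e A.
Proof.
move=> cA Ay Yy; rewrite -(imset_id A).
apply: (connected_in_image rt rooted_moved _ cA) => x Ax Apx xr.
rewrite imset_id; have [xc|xc] := eqVneq x c; last first.
  move: Apx; rewrite /moved_par (negbTE xc) => Apx; apply: connect1.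
  by rewrite /induced /= Ax Apx (edge_par rt).
have /subsetP PA : stem \subset A by apply: (stem_sub cA Ay Yy Ax); rewrite xc c_branch.
apply: (@connect_trans _ _ v0).
  apply: connect1; rewrite /induced /= Ax PA ?v0_stem //= -par_c -xc.
  exact: (edge_par rt).
rewrite /moved_par xc eqxx -(iter_height rt v0); apply: (connect_iter rt) => j _.
apply: PA; elim: j => [|j]; [exact: v0_stem | exact: stem_par].
Qed.

(** * Images of connected sets under reversal, contraction and exchange *)

Lemma reverse_height x : x \in stem -> h (phi x) = s - h x.
Proof. by rewrite inE /phi => ->; rewrite (height_iter rt). Qed.

Lemma reverse_stem x : (phi x \in stem) = (x \in stem).
Proof.
have [Px|] := boolP (x \in stem); first by rewrite inE reverse_height ?leq_subr.
by rewrite !inE /phi => /negbTE xs; rewrite !xs.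
Qed.

Lemma reverse_stemN x : x \notin stem -> phi x = x.
Proof. by rewrite inE /phi => /negbTE ->. Qed.

Lemma reverseK : involutive phi.
Proof.
move=> x; have [Px|Px] := boolP (x \in stem); last by rewrite !reverse_stemN.
have sx : h x <= s by move: Px; rewrite inE.
apply: unique_level; rewrite !reverse_height ?reverse_stem ?subKn //.
Qed.

Lemma reverse_branch x : x \in Zo -> phi x = x.
Proof. by move=> Zx; apply: reverse_stemN; rewrite stemE Zx andbF. Qed.

Lemma reverse_par x : x \in stem -> x != r -> par (phi (par x)) = phi x.
Proof.
move=> Px xr; have Ppx := stem_par Px; move: (Px); rewrite inE => sx.
apply: unique_level; rewrite (height_par rt) !reverse_height // (height_par rt);
  have := xr; rewrite -(height_eq0 rt); move: sx; lia.
Qed.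

Lemma reverse_root : phi r = v0.
Proof. by rewrite /phi (rooted_height0 rt). Qed.

(** If [A] meets [others], it contains the stem and is its own image. If not, [reverse] carries the
    edges inside [A] to edges of [e]: stem edges are flipped, and the edge from [c] to [r] becomes
    the one from [c] to [v0]. *)
Lemma connected_in_reverse A z : connected_in e1 A -> z \in A -> z \in Zo ->
  connected_in e (phi @: A).
Proof.
move=> cA Az Zz; have [/pred0P noY|/pred0Pn[y /andP[/= Ay Yy]]] :=
  boolP (pred0b [predI A & Yo]); last first.
  have /subsetP PA := stem_sub cA Ay Yy Az Zz.
  suff -> : phi @: A = A by apply: connected_in_others cA Ay Yy.
  have phiA x : x \in A -> phi x \in A.
    have [Px _|Px Ax] := boolP (x \in stem); last by rewrite reverse_stemN.
    by apply: PA; rewrite reverse_stem.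
  apply/setP => x; apply/imsetP/idP => [[u Au ->]|Ax]; first exact: phiA.
  by exists (phi x); rewrite ?reverseK ?phiA.
apply: (connected_in_image rt rooted_moved _ cA) => x Ax Apx xr; apply: connect1.
rewrite /induced /= !imset_f //=.
have [Px|Px] := boolP (x \in stem).
  rewrite moved_par_branchN ?stem_branchN // -(reverse_par Px xr) (rooted_sym rt).
  apply: (edge_par rt); rewrite -(height_eq0 rt) reverse_height ?stem_par //.
  rewrite (height_par rt); move: xr Px; rewrite -(height_eq0 rt) inE; lia.
have Zx : x \in Zo.
  by apply: contraNT Px => Zx; rewrite stemE Zx; have := noY x; rewrite /= Ax => /= ->.
rewrite reverse_branch // /moved_par; case: eqVneq => [xc|xc].
  by rewrite reverse_root -par_c -xc (edge_par rt).
by rewrite reverse_branch ?branch_par // (edge_par rt).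
Qed.

(** Contracting the branch to [r], where it hangs in the moved tree, leaves only edges common to
    both trees. *)
Lemma connected_in_retract A : connected_in e1 A ->
  connected_in e ((fun x => if x \in Zo then r else x) @: A).
Proof.
move=> cA; apply: (connected_in_image rt rooted_moved _ cA) => x Ax Apx xr.
have Zr := negbTE (stem_branchN root_stem).
have [Zx|Zx] := boolP (x \in Zo).
  rewrite /moved_par; case: eqVneq => [_|xc]; first by rewrite Zr connect0.
  by rewrite branch_par // connect0.
apply: connect1; rewrite moved_par_branchN // (negbTE (branchN_par Zx)) /induced /=.
rewrite moved_par_branchN // in Apx.
by rewrite (edge_par rt) // andbT; apply/andP; split; apply/imsetP;
  [exists x | exists (par x)] => //; rewrite ?(negbTE Zx) ?(negbTE (branchN_par Zx)).
Qed.

(* Exchanging [w] for the deepest vertex [m] costs nothing: a connected set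
   through [m] and [v0] has at least [h m - h v0 >= h w - h v0] vertices
   in [others], which pay for the chain from [v0] to [w]. *)
Lemma connected_in_exchange A b w : connected_in e1 A -> m \in A ->
  b \in A -> b \notin Yo -> w \in Zo ->
  exists B : {set V},
    [/\ connected_in e B, w |: (A :\: Yo) \subset B & #|B| <= #|A|].
Proof.
move=> cA1 Am Ab Yb Zw; have cA := connected_in_others cA1 Am m_others.
have YNpar x : x \in ~: Yo -> par x \in ~: Yo.
  by rewrite ![_ \in ~: _]in_setC; apply: othersN_par.
have iter_others i : i < h m - s -> iter i par m \in Yo.
  rewrite othersE (height_iter rt) ltn_subRL addnC -ltn_subRL => ->.
  by elim: i => [|i IHi]; [exact: others_branchN m_others | exact: branchN_par].
(* Since [b] lies outside [others], [A] must contain the climb from [m] up to [v0]. *)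
have iter_A i : i <= h m - s -> iter i par m \in A.
  elim: i => [//|i IHi] ism; have Yi := iter_others i ism.
  apply: (connected_in_climb rt cA YNpar Ab) (IHi (ltnW ism)) _; first by rewrite in_setC.
  by rewrite in_setC negbK.
have Av0 : v0 \in A.
  rewrite (stem_iter (y := m) v0_stem) ?m_top //; exact: iter_A.
have Yv0 : v0 \notin Yo by rewrite othersE ltnn.
(* Contract [others] to [v0], which frees room for the chain. *)
pose f x := if x \in Yo then v0 else x.
have fE x : x \notin Yo -> f x = x by rewrite /f => /negbTE ->.
have cfA : connected_in e (f @: A).
  apply: (connected_in_image rt rt _ cA) => x Ax Apx xr.
  have [Yx|Yx] := boolP (x \in Yo).
    have -> : f (par x) = f x; last exact: connect0.
    have [->|px] := eqVneq (par x) v0; first by rewrite fE // /f Yx.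
    by rewrite /f Yx others_par.
  apply: connect1; rewrite /induced /= !imset_f //= !fE ?othersN_par //.
  exact: (edge_par rt).
have fAv0 : v0 \in f @: A by rewrite -(fE v0 Yv0) imset_f.
(* The chain from [w] up to [c], without [v0]. *)
pose C' := [set iter (i : nat) par w | i : 'I_(h w - s)].
have v0E : v0 = iter (h w - s) par w.
  by apply: stem_iter v0_stem _; apply/ltnW/branch_height.
have CP i : i <= h w - s -> iter i par w \in v0 |: C'.
  rewrite leq_eqVlt => /orP[/eqP->|lti]; first by rewrite -v0E setU11.
  by apply/setU1P; right; apply/imsetP; exists (Ordinal lti).
have cC : connected_in e (v0 |: C').
  apply: (connected_in_par rt (a := v0)) => x /setU1P[-> /eqP//|/imsetP[i _ ->] _].
  rewrite -iterS CP //= -(height_eq0 rt) (height_iter rt); have := ltn_ord i; lia.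
exists (f @: A :|: (v0 |: C')); split.
- by apply: connected_inU (rooted_sym rt) fAv0 _ cfA cC; rewrite setU11.
- apply/subsetP => x /setU1P[->|/setDP[Ax Yx]]; rewrite inE.
    by rewrite (CP 0) ?orbT.
  by rewrite -(fE x Yx) imset_f.
have le_fA : #|f @: A| <= #|A :\: Yo|.
  apply/subset_leq_card/subsetP => _ /imsetP[x Ax ->]; rewrite inE /f.
  by case: ifPn => Yx; rewrite ?Yv0 ?Yx.
have le_C : #|C'| <= h w - s by apply: leq_trans (leq_imset_card _ _) _; rewrite card_ord.
have le_Y : h m - s <= #|A :&: Yo|.
  have inj : injective (fun i : 'I_(h m - s) => iter i par m).
    move=> i j /(congr1 h); rewrite !(height_iter rt) => hij; apply/val_inj => /=.
    by have := ltn_ord i; have := ltn_ord j; move: hij; lia.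
  rewrite -{1}[h m - s]card_ord -(card_imset _ inj).
  apply/subset_leq_card/subsetP => _ /imsetP[i _ ->].
  by rewrite inE iter_A ?iter_others // ltnW.
rewrite -(cardsID Yo A) addnC.
have le_CY := leq_trans le_C (leq_trans (leq_sub2r s (m_top w)) le_Y).
apply: leq_trans (leq_add le_fA le_CY).
have /setUidPl fAU : [set v0] \subset f @: A by rewrite sub1set.
rewrite setUA fAU; exact: (leq_card_setU (f @: A) C').1.
Qed.

(** * The bijection of sets and the comparison of averages *)

Definition twist S :=
  if (S :&: Zo != set0) && (S :&: Yo == set0) then phi @: S else S.

Lemma steiner_dist_twist S S' : S \subset S' -> 1 < #|S'| ->
  exists S'' : {set V}, [/\ twist S \subset S'', #|S''| = #|S'| &
    steiner_dist e S' <= steiner_dist e1 S''].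
Proof.
move=> SS' S'2; rewrite /twist; case: ifP => [/andP[/set0Pn[z /setIP[Sz Zz]] _]|twS].
  (* [S] is reversed, so reverse [S'] too. Since [reverse] fixes [z], every superset of the image
     meets the branch. *)
  exists (phi @: S'); split; first exact: imsetS.
    exact/card_imset/inv_inj/reverseK.
  apply: (steiner_dist_transfer rooted_moved rt) => A cA A0 /subsetP S'A.
  exists (phi @: A); split; last exact: leq_imset_card.
  - apply: (connected_in_reverse cA (z := z)) => //; apply: S'A.
    by rewrite -(reverse_branch Zz) imset_f // (subsetP SS').
  - apply/subsetP => x S'x; rewrite -[x]reverseK imset_f // S'A //.
    exact: imset_f.
  - by rewrite imset_eq0.
have [YS'|/set0Pn[y /setIP[S'y Yy]]] := eqVneq (S' :&: Yo) set0; last first.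
  (* [S'] meets [others]: connected sets through [y] in the moved tree stay connected in [e]. *)
  exists S'; split=> //.
  apply: (steiner_dist_transfer rooted_moved rt) => A cA A0 S'A.
  by exists A; split=> //; apply: connected_in_others cA _ Yy; apply: (subsetP S'A).
have YS : S :&: Yo == set0 by rewrite -subset0 -YS' setSI.
have {twS} ZS : S :&: Zo = set0 by apply/eqP; rewrite YS andbT in twS; apply: negbFE.
have YNS' x : x \in S' -> x \notin Yo.
  by move=> S'x; apply/negP => Yx; have := in_set0 x; rewrite -YS' inE S'x Yx.
have [ZS'|/set0Pn[w /setIP[S'w Zw]]] := eqVneq (S' :&: Zo) set0.
  (* [S'] lies in the stem, which the contraction of the branch fixes. *)
  exists S'; split=> //.
  apply: (steiner_dist_transfer rooted_moved rt) => A cA A0 /subsetP S'A.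
  exists ((fun x => if x \in Zo then r else x) @: A); split.
  - exact: connected_in_retract.
  - apply/subsetP => x S'x; apply/imsetP; exists x; first exact: S'A.
    by case: ifP => // Zx; have := in_set0 x; rewrite -ZS' inE S'x Zx.
  - by rewrite imset_eq0.
  - exact: leq_imset_card.
have mS' : m \notin S' by apply: contraL m_others; apply: YNS'.
(* [S] lies in the stem, so [w] is free to be exchanged for the deepest vertex [m]. *)
exists (m |: S' :\ w); split.
- apply/subsetP => x Sx; rewrite !inE (subsetP SS') // andbT.
  apply/orP; right; apply: contraTneq Sx => ->; apply/negP => Sw.
  by have := in_set0 w; rewrite -ZS inE Sw Zw.
- by rewrite cardsU1 (cardsD1 w S') S'w !inE (negbTE mS') andbF.
(* As [S'] has at least two elements, some [b] outside [others] remains and forces connected sets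
   through [m] to pass [v0]. *)
have [b] : exists b, b \in S' :\ w.
  by apply/card_gt0P; move: S'2; rewrite (cardsD1 w) S'w.
case/setD1P=> bw S'b.
apply: (steiner_dist_transfer rooted_moved rt) => A cA A0 /subsetP S''A.
have [|||B [cB wB leB]] := @connected_in_exchange A b w cA _ _ _ Zw.
- by apply: S''A; rewrite setU11.
- by apply: S''A; rewrite !inE bw S'b orbT.
- exact: YNS'.
exists B; split=> //; last by apply/set0Pn; exists w; apply: (subsetP wB); rewrite setU11.
apply: subset_trans wB; apply/subsetP => x S'x.
have [->|xw] := eqVneq x w; first exact: setU11.
by apply/setU1P; right; rewrite inE YNS' //= S''A // !inE xw S'x orbT.
Qed.

Lemma twist_card S : #|twist S| = #|S|.
Proof. by rewrite /twist; case: ifP => // _; apply/card_imset/inv_inj/reverseK. Qed.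

(** [reverse] moves only stem vertices, so reversing [S] does not change whether it meets the branch
    or [others]. *)
Lemma twistK : involutive twist.
Proof.
have phi2 S : phi @: (phi @: S) = S.
  by rewrite -imset_comp -[RHS]imset_id; apply: eq_imset => x; apply: reverseK.
have phiI (D S : {set V}) : {in D, phi =1 id} -> (phi @: S) :&: D = S :&: D.
  move=> phiD; apply/setP => x; rewrite !inE; apply: andb_id2r => Dx.
  by rewrite -{1}(phiD x Dx) mem_imset //; apply/inv_inj/reverseK.
move=> S; rewrite {2}/twist; case: ifP => tw; rewrite /twist; last by rewrite tw.
rewrite !phiI ?tw //.
  by move=> x Yx; apply: reverse_stemN; rewrite stemE Yx.
by move=> x; apply: reverse_branch.
Qed.

Lemma steiner_ecc_twist k S : 1 < k ->
  steiner_ecc e k S <= steiner_ecc e1 k (twist S).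
Proof.
move=> k2; apply/bigmax_leqP => S' /andP[SS' /eqP S'k].
have [|S'' [SS'' S''k le_d]] := steiner_dist_twist SS'; first by rewrite S'k.
by apply: leq_trans le_d _; apply: leq_bigmax_cond; rewrite SS'' S''k S'k eqxx.
Qed.

Lemma avg_steiner_ecc_le k l : 1 < k ->
  (avg_steiner_ecc e k l <= avg_steiner_ecc e1 k l)%R.
Proof.
move=> k2; rewrite /avg_steiner_ecc.
apply: Num.Theory.ler_wpM2r; first by rewrite Num.Theory.invr_ge0 Num.Theory.ler0n.
(* The sums are compared term by term after reindexing the one for the moved tree by [twist]. *)
rewrite Num.Theory.ler_nat [leqRHS](reindex_inj (inv_inj twistK)) /=.
rewrite [leqRHS](eq_bigl (fun S => #|S| == l)) => [|S]; last by rewrite twist_card.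
by apply: leq_sum => S _; apply: steiner_ecc_twist.
Qed.

(** * The moved tree is in sigma-form, and sigma undoes the move *)

Let p := traject par (par v0) (h v0).

Lemma mem_stem_path x : (x \in v0 :: p) = (x \in stem).
Proof.
rewrite -trajectS; apply/trajectP/idP => [[i _ ->]|Px].
  by elim: i => [|i]; [exact: v0_stem | exact: stem_par].
exists (s - h x); first by rewrite ltnS leq_subr.
by apply: stem_iter => //; move: Px; rewrite inE.
Qed.

Lemma path_edge_stem x : x \in stem -> x != r -> path_edge v0 p x (par x).
Proof.
have zipP n y i : i < n -> (iter i par y, iter i.+1 par y)
    \in zip (traject par y n.+1) (traject par (par y) n).
  elim: n y i => // n IHn y [|i] lti; first by rewrite /= mem_head.
  by apply: mem_behead; have := IHn (par y) i lti; rewrite -!iterSr.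
move=> Px xr; rewrite /path_edge /= /p; apply/orP; left.
have sx : h x <= s by move: Px; rewrite inE.
rewrite {1 2}(stem_iter Px sx) -iterS; apply: (zipP s v0).
by rewrite ltn_subrL height_v0 lt0n (height_eq0 rt) xr.
Qed.

Lemma subtree_others : subtree e1 (v0 |: Yo).
Proof.
apply: (connected_subtree rooted_moved); first by apply/set0Pn; exists v0; rewrite setU11.
apply: (connected_in_par rooted_moved (a := v0)) => x /setU1P[-> /eqP//|Yx] _.
rewrite moved_par_branchN ?others_branchN //; apply/andP; split.
  by rewrite !inE; case: eqVneq => //= px; have := others_par Yx px; rewrite inE.
rewrite -(height_eq0 rt) -lt0n; move: Yx; rewrite othersE.
by move=> /andP[/ltnW/(leq_trans height_v0)].
Qed.

Lemma branch_neq_r x : x \in Zo -> x != r.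
Proof. by move/branch_height; rewrite -(height_eq0 rt); case: (h x). Qed.

Lemma subtree_branch : subtree e1 (r |: Zo).
Proof.
apply: (connected_subtree rooted_moved); first by apply/set0Pn; exists r; rewrite setU11.
apply: (connected_in_par rooted_moved (a := r)) => x /setU1P[-> /eqP//|Zx] _.
rewrite branch_neq_r // andbT /moved_par; case: eqVneq => [_|xc]; first exact: setU11.
by apply/setU1P; right; apply: branch_par.
Qed.

(** In the moved tree a branch vertex [x] is within [h x - h v0] of [r], while [m] is at least
    [h m - h v0] away from [v0]. The cap in [height_le_dist] is handled by [dist_le_card]. *)
Lemma ecc_branch_others A : A \subset r |: Zo -> ecc e1 A r <= ecc e1 (v0 |: Yo) v0.
Proof.
move=> /subsetP AZ; have Ym := m_others.
have le_m : dist e1 m v0 <= ecc e1 (v0 |: Yo) v0.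
  by apply: (leq_bigmax_cond (F := dist e1^~ v0)); rewrite in_setU Ym orbT.
apply: leq_trans le_m; apply: leq_trans (height_le_dist rooted_moved _ _).
apply/bigmax_leqP => x /AZ Zx; rewrite leq_min dist_le_card andbT.
apply: leq_trans (dist_le_height rooted_moved x) _; rewrite /moved_height.
rewrite (negbTE (others_branchN Ym)) (negbTE (stem_branchN v0_stem)).
case/setU1P: Zx => [->|->]; last exact: leq_sub2r.
by rewrite (negbTE (stem_branchN root_stem)) (rooted_height0 rt).
Qed.

Lemma moved_sigma_form : sigma_form e1 v0 r p [set r] (v0 |: Yo) (r |: Zo).
Proof.
have v0r : v0 != r by rewrite -(height_eq0 rt) -lt0n.
have PE : [set x in v0 :: p] = stem by apply/setP => x; rewrite in_set mem_stem_path.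
split.
- exact: rooted_tree rooted_moved.
- apply: path_traject => i lti.
  have iP : iter i par v0 \in stem by rewrite inE (height_iter rt) leq_subr.
  rewrite -moved_par_branchN ?stem_branchN //; apply: (edge_par rooted_moved).
  by rewrite -(height_eq0 rt) (height_iter rt) subn_eq0 -ltnNge.
- rewrite -trajectS looping_uniq /looping.
  apply/negP => /trajectP[i lti] /(congr1 h)/eqP.
  rewrite (iter_height rt) (rooted_height0 rt) (height_iter rt).
  by rewrite eq_sym subn_eq0 leqNgt lti.
- by rewrite last_traject (iter_height rt).
- by rewrite size_traject.
- apply: (connected_subtree rooted_moved); first by apply/set0Pn; exists r; rewrite inE.
  by apply: (connected_in_par rooted_moved (a := r)) => x /set1P-> /eqP.
- exact: subtree_others.
- exact: subtree_branch.
- apply/setP => x; rewrite PE in_setT !in_setU stemE.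
  by case: (x \in Yo); case: (x \in Zo); rewrite ?orbT.
- have sym A x y : (x \in A) && (y \in A) = (y \in A) && (x \in A) by rewrite andbC.
  (* By symmetry it suffices to place the edge from a vertex to its parent. *)
  have edgeP x : x != r -> [|| (x \in [set r]) && (moved_par x \in [set r]),
      (x \in v0 |: Yo) && (moved_par x \in v0 |: Yo),
      (x \in r |: Zo) && (moved_par x \in r |: Zo) | path_edge v0 p x (moved_par x)].
    move=> xr; have [Zx|Zx] := boolP (x \in Zo).
      have -> : moved_par x \in r |: Zo.
        rewrite /moved_par; case: eqVneq => [_|xc]; first exact: setU11.
        by apply/setU1P; right; apply: branch_par.
      by rewrite [x \in r |: Zo]inE Zx !orbT.
    rewrite moved_par_branchN //; have [Yx|Yx] := boolP (x \in Yo).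
      rewrite [x \in v0 |: Yo]inE Yx orbT.
      have -> : par x \in v0 |: Yo; last by rewrite orbT.
      have [->|px] := eqVneq (par x) v0; first exact: setU11.
      by apply/setU1P; right; apply: others_par.
    by rewrite path_edge_stem ?orbT // stemE Yx.
  move=> x y /orP[]/andP[nr /eqP->]; first exact: edgeP.
  have := edgeP _ nr; rewrite ![(y \in _) && _]sym.
  by rewrite [path_edge _ _ _ _]orbC.
- rewrite PE; apply/setP => x; rewrite in_setI in_setU !in_set1.
  case: eqVneq => [->|xv] /=; first exact: v0_stem.
  by rewrite stemE; case: (x \in Yo).
- by rewrite PE; apply/setIidPl; rewrite sub1set root_stem.
- rewrite PE; apply/setP => x; rewrite in_setI in_setU !in_set1.
  case: eqVneq => [->|xv] /=; first exact: root_stem.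
  by rewrite stemE; case: (x \in Zo); rewrite ?andbF.
- by apply/setIidPl; rewrite sub1set setU11.
- rewrite setUA setUid; apply/pred0P => x /=; rewrite !in_setU !in_set1.
  have [->|xv] /= := eqVneq x v0.
    by rewrite (negbTE v0r) (negbTE (stem_branchN v0_stem)).
  apply/negP => /andP[Yx /orP[/eqP xr|Zx]]; last by have := others_branchN Yx; rewrite Zx.
  by have := root_stem; rewrite -xr stemE Yx.
- by exists c; [rewrite inE c_branch orbT | exact: c_neq_r].
- by rewrite geq_max !ecc_branch_others // sub1set setU11.
- by rewrite cards1 card_gt0; apply/set0Pn; exists v0; rewrite setU11.
Qed.

(** In the moved tree [c] is the only neighbour of [r] in the branch, so sigma exchanges just the
    edge from [c] to [r] for the one from [c] to [v0]. *)
Lemma sigma_moved : sigma e1 v0 r (r |: Zo) =2 e.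
Proof.
have cr := negbTE c_neq_r.
have moved y : (y \in (r |: Zo) :\ r) && e1 r y = (y == c).
  rewrite /moved_edge /= eqxx /=; have [->|yc] := eqVneq y c.
    by rewrite !inE cr connect0 /moved_par eqxx eqxx.
  rewrite in_setD1 in_setU1 /moved_par (negbTE yc); case: eqVneq => //= yr.
  apply/negP => /andP[Zy /eqP rp]; have := stem_branchN root_stem.
  by rewrite rp branch_par.
have cv : (c == v0) = false.
  by apply/negP => /eqP cv; have := height_c; rewrite cv => /n_Sn.
move=> x y; rewrite /sigma /= !moved (rooted_edge rt) /moved_edge /moved_par /=.
have [->|xc] := eqVneq x c; have [->|yc] := eqVneq y c;
  rewrite ?par_c ?cr ?cv ?(eq_sym c) ?cr ?cv ?(negbTE xc) ?(negbTE yc)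
    ?andbF ?andbT ?orbF //=.
all: by case: (_ == r); case: (_ == _); rewrite ?orbT ?orbF ?andbT.
Qed.
End MovedBranch.

(** * Choosing the root and the first branching vertex *)

Section Branching.
Variables (V : finType) (e : rel V).
Implicit Types (r x y v : V).

(** Relative to any root, a vertex of greatest height has no neighbour but its parent. *)
Lemma tree_leaf : is_tree e -> 0 < #|V| ->
  exists r, forall x y, e r x -> e r y -> x = y.
Proof.
move=> te /card_gt0P[r0 _]; have [par [h rt]] := tree_rooted r0 te.
case: (arg_maxnP h (isT : xpredT r0)) => r _ r_max; exists r.
have parE x : e r x -> x = par r.
  rewrite (rooted_edge rt) => /orP[/andP[_ /eqP//]|/andP[xr0 /eqP rx]].
  by have := r_max x isT; rewrite /= (rooted_heightS rt xr0) -rx ltnn.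
by move=> x y /parE-> /parE->.
Qed.

Section Rooted.
Variables (r : V) (par : V -> V) (h : V -> nat).
Hypothesis rt : rooted e r par h.

(** The root is excluded because [par] fixes it, which would make it a sibling of its own
    children. *)
Definition siblings x y := [&& x != y, x != r, y != r & par x == par y].

(** Induction on the height makes the parents equal, so distinct [x] and [y] would be siblings whose
    parent has height below [k]. *)
Lemma level_inj k :
  (forall x y, siblings x y -> k <= h (par x)) ->
  forall x y, h x = h y -> h x <= k -> x = y.
Proof.
move=> sib x y; have [j] := ubnP (h x); elim: j x y => // j IHj x y hj hxy hk.
have [xr|xr] := eqVneq x r.
  by apply/eqP; rewrite eq_sym xr -(height_eq0 rt) -hxy xr (rooted_height0 rt).
have yr : y != r by rewrite -(height_eq0 rt) -hxy (height_eq0 rt).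
have hp := rooted_heightS rt xr.
have pxy : par x = par y.
  apply: IHj; rewrite ?(height_par rt) ?hxy //; last first.
    by rewrite -hxy (leq_trans (leq_pred _)).
  by rewrite -hxy -ltnS prednK // hp.
apply/eqP; apply: contraTT hk => xy; rewrite -ltnNge hp ltnS.
by apply: (sib x y); rewrite /siblings xy xr yr pxy eqxx.
Qed.

(** Without siblings every level has at most one vertex, so the height is the isomorphism. *)
Lemma rooted_path_graph : (forall x y, ~~ siblings x y) ->
  graph_iso e (@path_graph #|V|).
Proof.
move=> sib; have h_inj : injective h.
  move=> x y hxy; apply: (level_inj (k := h x)) => // u v.
  by rewrite (negbTE (sib u v)).
exists (fun x => Ordinal (height_lt_card rt x)) => [|x y].
  by apply: inj_card_bij; rewrite ?card_ord // => x y /(congr1 val)/h_inj.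
have childE u v : ((h u).+1 == h v) = (v != r) && (u == par v).
  apply/eqP/andP => [huv|[vr /eqP->]]; last by rewrite -(rooted_heightS rt vr).
  have vr : v != r by rewrite -(height_eq0 rt) -huv.
  split=> //; apply/eqP/h_inj/succn_inj.
  by rewrite huv (rooted_heightS rt vr).
by rewrite /path_graph /= !childE (rooted_edge rt) orbC.
Qed.

(** Among all pairs of siblings take one whose parent is nearest to the root. A pair exists because
    the tree is not a path, and the parent is not [r] because [r] is a leaf. *)
Lemma first_branching : (forall x y, e r x -> e r y -> x = y) ->
  ~ graph_iso e (@path_graph #|V|) ->
  exists v0 c m, [/\ 0 < h v0,
    forall x y, h x = h y -> h x <= h v0 -> x = y,
    h c = (h v0).+1, forall x, h x <= h m & ~~ fconnect par m c].
Proof.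
move=> leaf npath.
have [/existsP[[x1 y1] sib1]|none] := boolP [exists xy, siblings xy.1 xy.2]; last first.
  case: npath; apply: rooted_path_graph => x y.
  by apply: contraNN none => sib; apply/existsP; exists (x, y).
case: (arg_minnP (P := fun xy => siblings xy.1 xy.2) (fun xy => h (par xy.1)) sib1).
case=> a b /= sib_ab min_ab; have /and4P[ab ar br /eqP pab] := sib_ab.
have [m _ m_top] := arg_maxnP h (isT : xpredT a).
have ha := rooted_heightS rt ar; have hb := rooted_heightS rt br.
(* At most one of the two siblings is [m] or an ancestor of [m]; the branch is taken at one that is
   not. *)
exists (par a), (if fconnect par m a then b else a), m; split.
- rewrite lt0n (height_eq0 rt); apply: contraNneq ab => par_a; apply/eqP/leaf.
    by rewrite (rooted_edge rt) ar par_a eqxx orbT.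
  by rewrite (rooted_edge rt) br -pab par_a eqxx orbT.
- by apply: level_inj => x y sib; apply: (min_ab (x, y)).
- by case: ifP; rewrite ?ha // hb pab.
- by move=> x; apply: m_top.
(* The siblings have the same height, and climbing from [m] meets only one vertex of that height. *)
case: ifPn => // /iter_findex ma; apply: contraNN ab => /iter_findex mb.
move: ma mb; move: (findex _ _ _) (findex _ _ _) => j i ma mb.
have hia : h m - i = (h (par a)).+1 by rewrite -(height_iter rt) ma.
have hjb : h m - j = (h (par a)).+1 by rewrite -(height_iter rt) mb hb pab.
have ij : i = j by lia.
by rewrite -ma ij mb.
Qed.

End Rooted.
End Branching.

Theorem theorem2 (k l n : nat) (hk : 2 <= k) (hl : 0 <= l <= k)
    (V : finType) (e' : rel V) (he' : is_tree e') (hV : #|V| = n)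
    (hn : k + 1 <= n) (hP : ~ graph_iso e' (@path_graph n)) :
  exists (e : rel V) (v0 vs : V) (p : seq V) (X Y Z : {set V}),
    [/\ sigma_form e v0 vs p X Y Z,
        sigma e v0 vs Z =2 e' &
        (avg_steiner_ecc e' k l <= avg_steiner_ecc e k l)%R].
Proof.
subst n; have [|r leaf] := tree_leaf he'; first by apply: leq_trans hn; rewrite addn1.
have [par [h rt]] := tree_rooted r he'.
have [v0 [c [m [v0_gt0 level hc m_top m_c]]]] := first_branching rt leaf hP.
exists (moved_edge r par c), v0, r, (traject par (par v0) (h v0)),
  [set r], (v0 |: others par h v0 c), (r |: branch par c).
split.
- exact: (moved_sigma_form rt v0_gt0 level hc m_top m_c).
- exact: (sigma_moved rt v0_gt0 level hc m_c).
- exact: (avg_steiner_ecc_le rt v0_gt0 level hc m_top m_c l hk).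
Qed.
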